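(* Let $K$ be a field, let $r\ge 2$ and $m,n\ge 1$ be integers, and let $f(X_1,\ldots,X_r)=a_0+a_1X_r+\cdots+a_mX_r^m$ and $g(X_1,\ldots,X_r)=b_0+b_1X_r+\cdots+b_nX_r^n$, with $a_0,a_1,\ldots,a_m,b_0,b_1,\ldots,b_n\in K[X_1,\ldots,X_{r-1}]$ and $a_0a_mb_n\neq 0$. Let $d_1\in K[X_1,\ldots,X_{r-1}]$ be a factor of $a_m$ and $d_2\in K[X_1,\ldots,X_{r-1}]$ a factor of $b_n$. If for an index $j\in\{1,\ldots,r-1\}$, $$\deg_{X_j}a_m>mn\deg_{X_j}d_1+m^2n\deg_{X_j}d_2+H_j(f),$$ then the polynomial $f(X_1,\ldots,X_{r-1},g(X_1,\ldots,X_r))$ has at most $\Omega(a_m/d_1)+m\,\Omega(b_n/d_2)$ irreducible factors over the field $K(X_1,\ldots,X_{r-1})$. The same conclusion holds in the wider range $$\deg_{X_j}a_m>n\deg_{X_j}d_1+mn\deg_{X_j}d_2+H_j(f),$$ provided that $f$ is irreducible over $K(X_1,\ldots,X_{r-1})$.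
   Context: For a polynomial $u$ in several variables, $\deg_{X_j}u$ is its degree as a polynomial in $X_j$ with coefficients in the polynomial ring in the remaining variables. For $f=a_0+a_1X_r+\cdots+a_mX_r^m$ with $a_i\in K[X_1,\ldots,X_{r-1}]$, $a_m\neq 0$, and $j\in\{1,\ldots,r-1\}$, $H_j(f)=\max\{\deg_{X_j}a_0,\deg_{X_j}a_1,\ldots,\deg_{X_j}a_{m-1}\}$ (zero coefficients are ignored in the maximum, i.e. $\deg_{X_j}0=-\infty$). For a nonzero $u\in K[X_1,\ldots,X_{r-1}]$, $\Omega(u)$ denotes the number of irreducible factors of $u$ in the ring $K[X_1,\ldots,X_{r-1}]$, counting multiplicities, with $\Omega(c)=0$ for nonzero constants $c\in K$. ''Irreducible (factors) over $K(X_1,\ldots,X_{r-1})$'' refers to polynomials in $X_r$ with coefficients in the field $K(X_1,\ldots,X_{r-1})$. *)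

(* Defs.v *)
From HB Require Import structures.
From mathcomp Require Import all_boot all_order all_algebra.
From mathcomp.multinomials Require Import mpoly.
From Stdlib Require Import ClassicalEpsilon.

Set Implicit Arguments.
Unset Strict Implicit.
Unset Printing Implicit Defensive.

Import GRing.Theory.
Local Open Scope ring_scope.

(* The value at u = 0 is 0 instead of -oo. *)
Definition degX (R : nzRingType) (n : nat) (j : 'I_n) (u : {mpoly R[n]}) : nat :=
  \max_(mon <- msupp u) mon j.

(* The leading coefficient is excluded from the maximum.  An empty maximum
   is 0; this cannot occur when f has positive degree and f`_0 != 0. *)
Definition Hcoef (R : nzRingType) (n : nat) (j : 'I_n)
    (f : {poly {mpoly R[n]}}) : nat :=
  \max_(i < (size f).-1 | f`_i != 0) degX j f`_i.

Definition irreducible_elt (R : idomainType) (p : R) : Prop :=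
  [/\ p != 0, p \isn't a GRing.unit
    & forall x y : R, p = x * y ->
        x \is a GRing.unit \/ y \is a GRing.unit].

(* u is a unit times a product of k irreducible elements, repetitions allowed. *)
Definition nb_factors (R : idomainType) (u : R) (k : nat) : Prop :=
  exists (c : R) (s : seq R),
    [/\ c \is a GRing.unit, u = c * \prod_(q <- s) q,
        forall q, q \in s -> irreducible_elt q & size s = k].

(* The number of irreducible factors of u, counted with multiplicity.  It is
   meaningful for u != 0 in a unique factorization domain, where exactly one
   k satisfies nb_factors u k. *)
Definition Omega (R : idomainType) (u : R) : nat :=
  epsilon (inhabits 0%N) (nb_factors u).

Lemma irreducible_elt_poly (F : fieldType) (p : {poly F}) :
  irreducible_elt p <-> irreducible_poly p.
Proof.
have unitE (q : {poly F}) : (q \is a GRing.unit) = (size q == 1).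
  rewrite poly_unitE; case: eqP => //= sq1.
  rewrite unitfE; move/eqP: sq1 => /size_poly1P[c c0 ->].
  by rewrite coefC eqxx.
split=> [[p0 pN irr]|[sp irr]].
  split=> [|q sq /dvdpP[x pE]].
    by rewrite ltn_neqAle eq_sym -unitE pN lt0n size_poly_eq0.
  have [] := irr _ _ pE; last by rewrite unitE (negPf sq).
  rewrite unitE => /size_poly1P[c c0 xE].
  by rewrite pE xE mul_polyC eqp_sym eqp_scale.
have p0 : p != 0 by rewrite -size_poly_gt0 (ltn_trans _ sp).
split=> [//||x y pE]; first by rewrite unitE neq_ltn sp orbT.
have [sy|sy] := eqVneq (size y) 1; first by right; rewrite unitE sy.
left; have /eqp_size : y %= p by apply: irr => //; rewrite pE dvdp_mull.
move: p0; rewrite pE mulf_eq0 negb_or => /andP[x0 y0].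
rewrite size_mul // unitE => /eqP.
rewrite -size_poly_gt0 in x0; rewrite -size_poly_gt0 in y0.
case: (size x) x0 => // a _; rewrite addSn /= -{1}[size y]add0n eqn_add2r.
by move/eqP<-.
Qed.

Lemma nb_factors_exists (R : idomainType) (N : R -> nat) :
  (forall x y : R, x != 0 -> y != 0 -> y \isn't a GRing.unit ->
     (N x < N (x * y)%R)%N) ->
  forall u : R, u != 0 -> nb_factors u (Omega u).
Proof.
move=> NM u u0; apply: epsilon_spec.
have [k leNk] := ubnP (N u); elim: k u u0 leNk => // k IH u u0 leNk.
have [uU|uN] := boolP (u \is a GRing.unit).
  by exists 0%N, u, [::]; split=> //; rewrite big_nil mulr1.
have [irr|nirr] := classic (irreducible_elt u).
  exists 1%N, 1, [:: u]; split=> //; rewrite ?unitr1 ?big_seq1 ?mul1r //.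
  by move=> q; rewrite inE => /eqP->.
have [x [y [uE xN yN]]] : exists x y : R,
    [/\ u = x * y, x \isn't a GRing.unit & y \isn't a GRing.unit].
  apply: NNPP => H; apply: nirr; split=> // x y uE.
  have [xU|xN] := boolP (x \is a GRing.unit); first by left.
  by right; apply: contraT => yN; case: H; exists x, y.
move: u0; rewrite uE mulf_eq0 negb_or => /andP[x0 y0].
rewrite uE in leNk.
have [|i [c [s [cU xE sP si]]]] := IH x x0.
  exact: leq_trans (NM _ _ x0 y0 yN) leNk.
have [|l [d [t [dU yE tP tl]]]] := IH y y0.
  by rewrite mulrC in leNk; apply: leq_trans (NM _ _ y0 x0 xN) leNk.
exists (i + l)%N, (c * d), (s ++ t); split.
- by rewrite unitrM cU.
- by rewrite big_cat /= {1}xE {1}yE mulrACA.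
- by move=> q; rewrite mem_cat => /orP[/sP|/tP].
- by rewrite size_cat si tl.
Qed.

Lemma OmegaP_poly (F : fieldType) (u : {poly F}) :
  u != 0 -> nb_factors u (Omega u).
Proof.
apply: (nb_factors_exists (N := fun p : {poly F} => size p)) => x y x0 y0.
rewrite size_mul // poly_unitE; move: x0; rewrite -size_poly_gt0.
case: eqP => [/eqP/size_poly1P[c c0 ->]|].
  by rewrite coefC unitfE c0.
move: y0; rewrite -size_poly_gt0; case: (size y) => [|[|l]] // _ _.
by rewrite !addnS /= ltnS leq_addr.
Qed.

Lemma OmegaP_mpoly (K : fieldType) (n : nat) (u : {mpoly K[n]}) :
  u != 0 -> nb_factors u (Omega u).
Proof.
apply: (nb_factors_exists (N := fun p : {mpoly K[n]} => msize p)).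
move=> x y x0 y0 yN; rewrite msizeM //.
have sx : (0 < msize x)%N by rewrite lt0n msize_poly_eq0.
have sy : (1 < msize y)%N.
  rewrite ltnNge; apply: contra yN => /msize1_polyC yE.
  have c0 : y@_0%MM != 0 by apply: contraNneq y0 => c0; rewrite yE c0.
  apply/unitrP; exists (y@_0%MM)^-1%:MP.
  by rewrite yE mcoeffC eqxx mulr1 -!mpolyCM mulVf ?mulfV // mpolyC1.
by case: (msize y) sy => [|[|l]] // _; rewrite !addnS /= ltnS leq_addr.
Qed.

(* Main.v *)
Require Import Defs.
From mathcomp Require Import all_boot all_order all_algebra.
From mathcomp.multinomials Require Import mpoly.
From mathcomp Require Import zify ring.
From Stdlib Require Import Classical_Prop.

Set Implicit Arguments.
Unset Strict Implicit.
Unset Printing Implicit Defensive.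

Import GRing.Theory.
Local Open Scope ring_scope.

(** Write R for K[X_1, ..., X_(r-1)] and F for its field of fractions, and let
    D be the degree in X_j. Two opposite estimates are played against each
    other.

    Suppose that f(g) has more than Omega(e1) + m Omega(e2) irreducible factors
    over F. As R is a unique factorization domain ([factorial_mpoly]), Gauss's
    lemma moves these factors into R[X] ([gauss_irreducible_factors]); their
    leading coefficients then divide a_m b_n^m = (d1 d2^m) (e1 e2^m). There are
    more factors than primes in e1 e2^m, so one of them, h, can be chosen with
    a leading coefficient t that divides d1 d2^m up to a unit
    ([exists_light_factor]). Hence D t <= D d1 + m D d2.

    On the other hand let h have degree s, with roots theta over an algebraic
    closure. Each g(theta) is a root of f. Since D a_m exceeds the D a_i by at
    least e := D a_m - H_j(f), the Newton polygon of f for the valuation -D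
    shows that every root of f has degree at most -e/m. The resultant
    t^n prod g(theta) of h and g is a nonzero element of R, so its degree is
    nonnegative: 0 <= n D t - s e / m. That is e s <= m n D t
    ([factor_lead_degree]), which contradicts the hypothesis as soon as s >= 1,
    respectively s >= m; the latter holds when f is irreducible because g(theta)
    then has degree m over F ([irreducible_size_leq_factor]).

    No root is actually adjoined. The polynomial t^n prod (Y - g(theta)) is
    t^n times the characteristic polynomial of the multiplication by g on
    F[X]/(h); it has coefficients in R because it is a Sylvester determinant
    ([integral_char_poly]), and it divides a power of f up to a constant by the
    argument of the Cayley-Hamilton theorem ([char_poly_dvd_exp]). The slope of
    the Newton polygon passes from f to its powers and to their factors by
    multiplicativity of the weighted degree ([top_heavyM],
    [top_heavy_factor]). *)

Local Notation fracp := (map_poly (@tofrac _)).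

(** * Prime elements and unique factorization *)

Definition divides (R : nzRingType) (a b : R) := exists c, b = c * a.

Definition prime_elt (R : idomainType) (p : R) : Prop :=
  [/\ p != 0, p \isn't a GRing.unit
    & forall x y, divides p (x * y) -> divides p x \/ divides p y].

Definition prime_factored (R : idomainType) (u : R) : Prop :=
  exists (c : R) (s : seq R),
    [/\ c \is a GRing.unit, u = c * \prod_(q <- s) q
      & forall q, q \in s -> prime_elt q].

Definition factorial_domain (R : idomainType) : Prop :=
  forall u : R, u != 0 -> prime_factored u.

Lemma divides_mull (R : nzRingType) (a b c : R) :
  divides a b -> divides a (c * b).
Proof. by case=> d ->; exists (c * d); rewrite mulrA. Qed.

Lemma divides_add (R : nzRingType) (a b c : R) :
  divides a b -> divides a c -> divides a (b + c).
Proof. by move=> [x ->] [y ->]; exists (x + y); rewrite mulrDl. Qed.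

Lemma prime_dvd_unit (R : idomainType) (p c : R) :
  prime_elt p -> c \is a GRing.unit -> ~ divides p c.
Proof.
case=> _ pN _ cU [d cE]; move: cU; rewrite cE unitrM => /andP[_ pU].
by rewrite pU in pN.
Qed.

Lemma prime_dvd_prod (R : idomainType) (p : R) (s : seq R) :
  prime_elt p -> divides p (\prod_(x <- s) x) ->
  exists2 x, x \in s & divides p x.
Proof.
move=> pP; elim: s => [|x s IH].
  by rewrite big_nil => /(prime_dvd_unit pP (unitr1 _)).
rewrite big_cons => /(let: And3 _ _ H := pP in H)[px|/IH[y ys py]].
  by exists x => //; rewrite inE eqxx.
by exists y => //; rewrite inE ys orbT.
Qed.

(** A factorization of q into primes has a single prime in it. *)
Lemma irreducible_prime (R : idomainType) (q : R) :
  factorial_domain R -> irreducible_elt q -> prime_elt q.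
Proof.
move=> facR [q0 qN irr]; have [c [[|p s] [cU qE sP]]] := facR q q0.
  by move: qN; rewrite qE big_nil mulr1 cU.
have pP : prime_elt p by apply: sP; rewrite inE eqxx.
have : q = (c * \prod_(x <- s) x) * p by rewrite qE big_cons mulrCA mulrC.
move=> qE'; case: (irr _ _ qE') => [wU|pU]; last first.
  by case: pP => _ /negP; rewrite pU.
rewrite qE'; case: pP; set w := c * _ in wU *; move=> p0 pN pP.
split=> //.
- by rewrite mulf_neq0 //; apply: contraTneq wU => ->; rewrite unitr0.
- by rewrite unitrM wU.
have wp z : divides p z -> divides (w * p) z.
  by case=> d ->; exists (d / w); rewrite mulrA divrK.
move=> x y [d xyE]; have /pP[] : divides p (x * y).
- by exists (d * w); rewrite xyE mulrA.
- by left; apply: wp.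
by right; apply: wp.
Qed.

Lemma polyC_dvd_coef (R : idomainType) (p : R) (A : {poly R}) i :
  divides p%:P A -> divides p A`_i.
Proof. by case=> B ->; exists B`_i; rewrite coefMC. Qed.

(** In other words (R/p)[X] is a domain because R/p is. When p divides A B it
    divides the product of the leading coefficients, hence one of them, and the
    corresponding leading term can be dropped. *)
Lemma prime_polyC (R : idomainType) (p : R) :
  prime_elt p -> prime_elt p%:P.
Proof.
move=> pP; have [p0 pN pM] := pP; split; first by rewrite polyC_eq0.
  apply: contra pN; rewrite poly_unitE coefC eqxx; by case/andP.
move=> A B; have [k] := ubnP (size A + size B)%N.
elim: k A B => // k IH A B lek pAB.
have [->|A0] := eqVneq A 0; first by left; exists 0; rewrite mul0r.
have [->|B0] := eqVneq B 0; first by right; exists 0; rewrite mul0r.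
have drop (C D : {poly R}) : C != 0 -> (size C + size D < k.+1)%N ->
    divides p%:P (C * D) -> divides p (lead_coef C) ->
    divides p%:P C \/ divides p%:P D.
  move=> C0 leCD pCD [c lcE].
  pose M := lead_coef C *: 'X^((size C).-1).
  have pM' : divides p%:P M.
    by exists (c *: 'X^((size C).-1)); rewrite /M lcE -!mul_polyC polyCM mulrAC.
  pose C' := C - M.
  have CE : C = C' + M by rewrite subrK.
  have sC' : (size C' < size C)%N.
    rewrite -[X in (_ < X)%N]prednK ?size_poly_gt0 // ltnS.
    apply/leq_sizeP => i; rewrite leq_eqVlt coefB coefZ coefXn => /orP[/eqP<-|lti].
      by rewrite eqxx mulr1 lead_coefE subrr.
    rewrite gtn_eqF // mulr0 subr0 nth_default //.
    by move: lti; rewrite prednK ?size_poly_gt0.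
  case: (IH C' D).
  - by rewrite -ltnS; apply: leq_ltn_trans leCD; rewrite ltn_add2r.
  - rewrite mulrBl; apply: divides_add => //.
    by rewrite mulrC -mulNr; apply: divides_mull.
  - by left; rewrite CE; apply: divides_add.
  by right.
have := polyC_dvd_coef (size A + size B).-2 pAB.
have -> : (A * B)`_(size A + size B).-2 = lead_coef A * lead_coef B.
  rewrite -lead_coefM lead_coefE size_mul //.
case/pM => pl; first exact: drop.
by rewrite or_comm; apply: drop; rewrite // 1?addnC // mulrC.
Qed.

(** Each prime of ps is absorbed by c or by one entry of ts. In the second case
    that entry is moved into c, so one prime costs at most one entry; an entry
    which absorbs no prime is left over. *)
Lemma pigeonhole_primes (R : idomainType) (D c : R) (ps ts : seq R) :
  (forall p, p \in ps -> prime_elt p) ->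
  D * \prod_(p <- ps) p = c * \prod_(t <- ts) t ->
  (size ps < size ts)%N -> exists2 t, t \in ts & divides t D.
Proof.
elim: ps c ts => [|p ps IH] c ts psP.
  rewrite big_nil mulr1; case: ts => // t ts DE _.
  exists t; first by rewrite inE eqxx.
  by exists (c * \prod_(x <- ts) x); rewrite DE big_cons mulrCA mulrC.
have psP' q : q \in ps -> prime_elt q by move=> qs; apply: psP; rewrite inE qs orbT.
have pP : prime_elt p by apply: psP; rewrite inE eqxx.
have [p0 _ pM] := pP.
rewrite big_cons => E /= lts.
have /pM[[c' cE]|/(prime_dvd_prod pP)[t tts [t' tE]]] :
    divides p (c * \prod_(t <- ts) t).
- by rewrite -E; exists (D * \prod_(q <- ps) q); rewrite mulrCA mulrC.
- apply: (IH c') => //; last exact: ltnW.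
  by apply: (mulfI p0); rewrite mulrCA E cE mulrCA mulrA.
have [||x xs xD] := IH (c * t') (rem t ts) psP'.
- apply: (mulfI p0); rewrite mulrCA E (perm_big _ (perm_to_rem tts)) big_cons /=.
  move: (\prod_(_ <- rem t ts) _) => Q; rewrite tE.
  by rewrite -!mulrA [t' * _]mulrCA [c * (p * _)]mulrCA.
- by rewrite size_rem // -ltnS (leq_trans lts) // leqSpred.
by exists x => //; apply: mem_rem xs.
Qed.

(** * Gauss's lemma *)

Lemma fraction_num_den (R : idomainType) (x : {fraction R}) :
  exists2 d : R, d != 0 & exists n : R, tofrac d * x = tofrac n.
Proof.
elim/quotW: x => -[[n d] /= d0]; exists d => //; exists n.
rewrite /tofrac; unlock FracField.tofrac; rewrite !piE; apply/eqmodP => /=.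
rewrite /FracField.equivf /= /FracField.mulf.
by rewrite !numden_Ratio ?mulr1 ?mul1r ?oner_neq0.
Qed.

Lemma tofrac_inj (R : idomainType) : injective (@tofrac R).
Proof. by move=> x y /eqP; rewrite tofrac_eq => /eqP. Qed.

Lemma fracp_inj (R : idomainType) : injective (map_poly (@tofrac R)).
Proof. exact: map_inj_poly (@tofrac_inj R) (tofrac0 R). Qed.

Lemma size_fracp (R : idomainType) (A : {poly R}) : size (fracp A) = size A.
Proof. exact: size_map_inj_poly (@tofrac_inj R) (tofrac0 R) A. Qed.

Lemma fracp_eq0 (R : idomainType) (A : {poly R}) : (fracp A == 0) = (A == 0).
Proof. by rewrite -!size_poly_eq0 size_fracp. Qed.

Lemma clear_denominators (R : idomainType) (A : {poly {fraction R}}) :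
  exists2 c : R, c != 0 & exists A' : {poly R}, fracp A' = tofrac c *: A.
Proof.
elim/poly_ind: A => [|A a [c c0 [A' A'E]]].
  by exists 1; rewrite ?oner_neq0 //; exists 0; rewrite rmorph0 scaler0.
have [d d0 [n nE]] := fraction_num_den a.
exists (c * d); first by rewrite mulf_neq0.
exists (d *: A' * 'X + (c * n)%:P).
rewrite rmorphD rmorphM /= map_polyZ map_polyX map_polyC /= A'E scalerDr.
rewrite !tofracM -nE -!mul_polyC !polyCM; congr (_ + _); last by rewrite mulrA.
by rewrite mulrA [_%:P * _%:P]mulrC mulrA.
Qed.

Lemma eqp_irreducible (F : fieldType) (p q : {poly F}) :
  p %= q -> irreducible_poly p -> irreducible_poly q.
Proof.
move=> pq [sp irr]; split=> [|d sd dq]; first by rewrite -(eqp_size pq).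
by rewrite -(eqp_rtrans pq); apply: irr; rewrite ?(eqp_dvdr _ pq).
Qed.

Lemma mulr_polyC (R : comNzRingType) (c : R) (A : {poly R}) : A * c%:P = c *: A.
Proof. by rewrite mulrC mul_polyC. Qed.

(** Gauss's lemma in the form used below: each prime of the constant on the left
    divides A or B in R[X], and can be cancelled there. This changes A and B
    only by constants. *)
Lemma cancel_primes (R : idomainType) (u : R) (s : seq R) (U A B : {poly R}) :
  u \is a GRing.unit -> (forall p, p \in s -> prime_elt p) ->
  (u * \prod_(p <- s) p) *: U = A * B ->
  exists A' B', [/\ U = A' * B', fracp A' %= fracp A & fracp B' %= fracp B].
Proof.
move=> uU; elim: s A B => [|p s IH] A B sP.
  rewrite big_nil mulr1 => UE; exists (u^-1 *: A), B; split; last exact: eqpxx.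
    by rewrite -scalerAl -UE scalerA mulVr // scale1r.
  rewrite map_polyZ eqp_scale // tofrac_eq0 invr_eq0.
  by apply: contraTneq uU => ->; rewrite unitr0.
rewrite big_cons => UE.
have pP : prime_elt p by apply: sP; rewrite inE eqxx.
have sP' q : q \in s -> prime_elt q by move=> qs; apply: sP; rewrite inE qs orbT.
have p0 : p != 0 by case: pP.
have fp0 : tofrac p != 0 by rewrite tofrac_eq0.
have pE (C : {poly R}) : fracp C %= fracp (C * p%:P).
  by rewrite mulr_polyC map_polyZ eqp_sym eqp_scale.
have [_ _ pM] := prime_polyC pP.
have : divides p%:P (A * B).
  exists ((u * \prod_(q <- s) q) *: U).
  by rewrite mulr_polyC scalerA -UE mulrCA.
have pI : injective (fun C : {poly R} => C * p%:P).
  by apply: mulIf; rewrite polyC_eq0.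
case/pM => -[C CE].
  have [|A' [B' [UE' A'E B'E]]] := IH C B sP'.
    apply: pI; rewrite mulrAC -CE -UE.
    by rewrite mulr_polyC scalerA mulrCA.
  by exists A', B'; split=> //; apply: eqp_trans A'E _; rewrite CE.
have [|A' [B' [UE' A'E B'E]]] := IH A C sP'.
  apply: pI; rewrite -mulrA -CE -UE.
  by rewrite mulr_polyC scalerA mulrCA.
by exists A', B'; split=> //; apply: eqp_trans B'E _; rewrite CE.
Qed.

Lemma gauss_factor (R : idomainType) (U : {poly R}) (A B : {poly {fraction R}}) :
  factorial_domain R -> fracp U = A * B ->
  exists A' B', [/\ U = A' * B', fracp A' %= A & fracp B' %= B].
Proof.
move=> facR UE.
have [a a0 [A1 A1E]] := clear_denominators A.
have [b b0 [B1 B1E]] := clear_denominators B.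
have ab0 : a * b != 0 by rewrite mulf_neq0.
have [u [s [uU abE sP]]] := facR _ ab0.
have [|A' [B' [UE' A'E B'E]]] :=
  cancel_primes (U := U) (A := A1) (B := B1) uU sP.
  apply: fracp_inj; rewrite -abE map_polyZ /= UE tofracM rmorphM /= A1E B1E.
  by rewrite -scalerAl -scalerAr scalerA.
exists A', B'; split=> //.
  by apply: eqp_trans A'E _; rewrite A1E eqp_scale // tofrac_eq0.
by apply: eqp_trans B'E _; rewrite B1E eqp_scale // tofrac_eq0.
Qed.

Lemma gauss_irreducible_factors (R : idomainType) (U : {poly R})
    (s : seq {poly {fraction R}}) :
  factorial_domain R -> fracp U %= \prod_(q <- s) q ->
  (forall q, q \in s -> irreducible_poly q) ->
  exists u (s' : seq {poly R}), [/\ size s' = size s,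
    U = u%:P * \prod_(h <- s') h
    & forall h, h \in s' -> irreducible_poly (fracp h)].
Proof.
move=> facR; elim: s U => [|q s IH] U.
  rewrite big_nil => /eqp_size; rewrite size_poly1 size_fracp => sU _.
  exists U`_0, [::]; split=> //.
  by rewrite big_nil mulr1; apply: size1_polyC; rewrite sU.
rewrite big_cons => /eqpf_eq[c c0]; rewrite scalerAl => UE sP.
have [A [B [UE' AE BE]]] := gauss_factor facR UE.
have [|u [s' [ss' BE' sP']]] := IH B BE.
  by move=> x xs; apply: sP; rewrite inE xs orbT.
exists u, (A :: s'); split; first by rewrite /= ss'.
  by rewrite UE' BE' big_cons mulrCA.
move=> h; rewrite inE => /orP[/eqP->|/sP'//].
have : irreducible_poly q by apply: sP; rewrite inE eqxx.
apply: eqp_irreducible; rewrite eqp_sym; apply: eqp_trans AE _.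
exact: eqp_scale.
Qed.

Lemma irreducible_factorization (F : fieldType) (p : {poly F}) : p != 0 ->
  exists s : seq {poly F}, p %= \prod_(q <- s) q /\
    forall q, q \in s -> irreducible_poly q.
Proof.
move=> p0; have [c [s [cU pE sP _]]] := OmegaP_poly p0.
exists s; split; last by move=> q /sP/irreducible_elt_poly.
rewrite pE; move: cU; rewrite poly_unitE => /andP[/size_poly1P[a a0 ->] _].
by rewrite mul_polyC eqp_scale.
Qed.

(** If A divides B over the field of fractions, then c B = Q A for some c in R.
    The primes of c are primes of R[X] and do not divide A, so they can be
    cancelled from Q: divisibility by A may be tested over the field, where
    irreducible elements are prime. *)
Lemma primitive_prime (R : idomainType) (A : {poly R}) :
  factorial_domain R -> irreducible_poly (fracp A) ->
  (forall p : R, prime_elt p -> ~ divides p%:P A) -> prime_elt A.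
Proof.
move=> facR irrA prA.
have A0 : A != 0 by rewrite -fracp_eq0 irredp_neq0.
have dvA (B : {poly R}) : fracp A %| fracp B -> divides A B.
  case/dvdpP => Q BE; have [a a0 [Q' Q'E]] := clear_denominators Q.
  have [u [s [uU aE sP]]] := facR _ a0.
  have {BE} : a *: B = Q' * A.
    by apply: fracp_inj; rewrite map_polyZ rmorphM /= BE Q'E scalerAl.
  rewrite {}aE {a0 Q'E}; elim: s Q' sP => [|p s IH] Q' sP.
    rewrite big_nil mulr1 => BE; exists (u^-1 *: Q').
    by rewrite -scalerAl -BE scalerA mulVr // scale1r.
  have pP : prime_elt p by apply: sP; rewrite inE eqxx.
  have sP' q : q \in s -> prime_elt q by move=> qs; apply: sP; rewrite inE qs orbT.
  have [p0 _ pM] := prime_polyC pP.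
  rewrite big_cons mulrCA => BE.
  have : divides p%:P (Q' * A).
    exists ((u * \prod_(q <- s) q) *: B).
    by rewrite -BE mulr_polyC scalerA.
  case/pM => [[C CE]|/prA//]; apply: (IH C sP').
  apply: (mulfI p0); rewrite mul_polyC scalerA BE CE.
  by rewrite -mulrA mulrCA.
split=> // [|B C [D BCE]].
  apply/negP; rewrite poly_unitE => /andP[/eqP sA _].
  by case: irrA; rewrite size_fracp sA.
have : fracp A %| fracp B * fracp C by rewrite -rmorphM /= BCE rmorphM dvdp_mull.
have [/Gauss_dvdpr ->|/negP] := boolP (coprimep (fracp A) (fracp B)).
  by move/dvA; right.
have [/eqP gA|gN] := eqVneq (size (gcdp (fracp A) (fracp B))) 1%N.
  by rewrite /coprimep gA.
move=> _ _; left; apply: dvA.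
by rewrite -(eqp_dvdl _ (irrA.2 _ gN (dvdp_gcdl _ _))) dvdp_gcdr.
Qed.

(** * Unique factorization in polynomial rings *)

Lemma prime_factoredM (R : idomainType) (x y : R) :
  prime_factored x -> prime_factored y -> prime_factored (x * y).
Proof.
move=> [c [s [cU -> sP]]] [d [t [dU -> tP]]].
exists (c * d), (s ++ t); split; first by rewrite unitrM cU.
  by rewrite big_cat mulrACA.
by move=> q; rewrite mem_cat => /orP[/sP|/tP].
Qed.

Lemma prime_prime_factored (R : idomainType) (p : R) :
  prime_elt p -> prime_factored p.
Proof.
move=> pP; exists 1, [:: p]; split; rewrite ?unitr1 ?big_seq1 ?mul1r //.
by move=> q; rewrite inE => /eqP->.
Qed.

Lemma prime_dvd_prime (R : idomainType) (p q d : R) :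
  prime_elt p -> prime_elt q -> q = d * p -> d \is a GRing.unit.
Proof.
move=> [p0 pN _] [q0 _ qM] qE.
have /qM[[e dE]|[e pE]] : divides q (d * p) by exists 1; rewrite mul1r.
  case/negP: pN; apply/unitrP.
  suff ep : e * p = 1 by exists e; rewrite [p * e]mulrC.
  have d0 : d != 0 by apply: contraNneq q0 => d0; rewrite qE d0 mul0r.
  by apply: (mulfI d0); rewrite mulr1 {2}dE qE mulrCA.
apply/unitrP; suff ed : e * d = 1 by exists e; rewrite [d * e]mulrC.
by apply: (mulIf p0); rewrite mul1r {2}pE qE mulrA.
Qed.

(** Pulling a prime constant out of A removes one prime from its leading
    coefficient, so this stops at a primitive polynomial. *)
Lemma irreducible_prime_factored (R : idomainType) (A : {poly R}) :
  factorial_domain R -> irreducible_poly (fracp A) -> prime_factored A.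
Proof.
move=> facR irrA.
have A0 : A != 0 by rewrite -fracp_eq0 irredp_neq0.
have [|c [s [cU lcE sP]]] := facR (lead_coef A); first by rewrite lead_coef_eq0.
have [k] := ubnP (size s); elim: k c s A irrA A0 cU lcE sP => // k IH c s A.
move=> irrA A0 cU lcE sP lek.
have [[p [pP pA]]|prA] := classic (exists p, prime_elt p /\ divides p%:P A);
  last first.
  apply: prime_prime_factored; apply: primitive_prime => // p pP pA.
  by apply: prA; exists p.
have [p0 _ pM] := pP.
case: pA => B BE.
have lcBE : lead_coef B * p = c * \prod_(q <- s) q.
  by rewrite -lcE BE lead_coefM lead_coefC.
rewrite BE; apply: prime_factoredM; last exact/prime_prime_factored/prime_polyC.
have : divides p (c * \prod_(q <- s) q) by exists (lead_coef B).
case/pM => [/(prime_dvd_unit pP cU)//|/(prime_dvd_prod pP)[q qs [d qE]]].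
have dU := prime_dvd_prime pP (sP q qs) qE.
apply: (IH (c * d) (rem q s)).
- apply: eqp_irreducible irrA.
  by rewrite BE mulr_polyC map_polyZ eqp_scale ?tofrac_eq0.
- by apply: contraNneq A0 => B0; rewrite BE B0 mul0r.
- by rewrite unitrM cU.
- apply: (mulIf p0); rewrite lcBE (perm_big _ (perm_to_rem qs)) big_cons /=.
  by move: (\prod_(_ <- rem q s) _) => Q; rewrite qE -!mulrA [p * Q]mulrC.
- by move=> x /mem_rem/sP.
have : (0 < size s)%N by case: (s) qs.
by rewrite size_rem //; case: (size s) lek.
Qed.

Lemma factorial_poly (R : idomainType) :
  factorial_domain R -> factorial_domain {poly R}.
Proof.
move=> facR U U0.
have [|s [UE sP]] := @irreducible_factorization _ (fracp U).
  by rewrite fracp_eq0.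
have [u [t [_ UE' tP]]] := gauss_irreducible_factors facR UE sP.
rewrite UE' in U0 *; move: U0; rewrite mulf_eq0 polyC_eq0 negb_or => /andP[u0 _].
apply: prime_factoredM.
  have [c [r [cU -> rP]]] := facR u u0.
  exists c%:P, (map polyC r); split; first exact: rmorph_unit.
    by rewrite polyCM big_map rmorph_prod.
  by move=> q /mapP[p pr ->]; apply/prime_polyC/rP.
elim: t tP {UE'} => [|h t IH] tP.
  by rewrite big_nil; exists 1, [::]; rewrite big_nil mulr1 unitr1.
rewrite big_cons; apply: prime_factoredM.
  by apply: irreducible_prime_factored => //; apply: tP; rewrite inE eqxx.
by apply: IH => q qt; apply: tP; rewrite inE qt orbT.
Qed.

Lemma factorial_iso (R S : idomainType) (phi : {rmorphism R -> S}) :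
  bijective phi -> factorial_domain S -> factorial_domain R.
Proof.
case=> psi phiK psiK facS u u0.
have phiI := can_inj phiK.
have [|c [s [cU uE sP]]] := facS (phi u); first by rewrite -(rmorph0 phi) inj_eq.
exists (psi c), (map psi s); split.
- apply/unitrP; exists (psi c^-1).
  by split; apply: phiI; rewrite rmorphM rmorph1 !psiK ?mulVr ?mulrV.
- apply: phiI; rewrite uE rmorphM rmorph_prod big_map psiK; congr (_ * _).
  by apply: eq_bigr => q _; rewrite psiK.
move=> _ /mapP[q qs ->]; have [q0 qN qM] := sP q qs.
have dE x : divides q (phi x) -> divides (psi q) x.
  by case=> d xE; exists (psi d); apply: phiI; rewrite xE rmorphM !psiK.
split.
- by apply: contraNneq q0 => p0; rewrite -[q]psiK p0 rmorph0.
- by apply: contra qN => pU; rewrite -[q]psiK rmorph_unit.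
move=> x y [d xyE]; case: (qM (phi x) (phi y)).
- by exists (phi d); rewrite -rmorphM xyE rmorphM psiK.
- by move/dE; left.
by move/dE; right.
Qed.

Lemma muniX (R : nzRingType) n : muni ('X_ord_max : {mpoly R[n.+1]}) = 'X.
Proof.
rewrite muniE msuppX big_seq1 mcoeffX eqxx scale1r mnm1E eqxx expr1.
rewrite (_ : [multinom _ | _ < _] = 0%MM) ?mpolyX0 ?scale1r //.
by apply/mnmP => i; rewrite mnmE mnm1E mnm0E -val_eqE /= gtn_eqF.
Qed.

Lemma muni_mwiden (R : nzRingType) n (p : {mpoly R[n]}) : muni (mwiden p) = p%:P.
Proof.
elim/mpolyind: p => [|c m p _ _ IH]; first by rewrite mwiden0 muni0.
rewrite mwidenD muniD IH polyCD; congr (_ + _).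
rewrite mwidenZ mwidenX muniZ muniE msuppX big_seq1 mcoeffX eqxx scale1r.
rewrite mnmwiden_ordmax expr0 scale_polyC scale_polyC mulr1 -mul_mpolyC.
congr (_ * _)%:P.
by congr 'X_[_]; apply/mnmP => i; rewrite mnmE mnmwiden_widen.
Qed.

Lemma mmultiK_monomial (R : comNzRingType) n c (m : 'X_{1..n.+1}) :
  (map_poly (@mwiden n R) (muni (c *: 'X_[m]))).['X_ord_max] = c *: 'X_[m].
Proof.
rewrite muniZ muniE msuppX big_seq1 mcoeffX eqxx scale1r scalerA.
rewrite map_polyZ map_polyXn.
rewrite hornerZ hornerXn rmorphM /= mwidenC mwidenX mul_mpolyC -scalerAl.
congr (_ *: _).
rewrite mpolyXn -mpolyXD; congr 'X_[_]; apply/mnmP => i.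
rewrite mnmDE mulmnE mnm1E.
case: (unliftP ord_max i) => [k ->|->].
  rewrite (_ : lift ord_max k = widen_ord (leqnSn n) k); last first.
    by apply/val_inj; rewrite /= /bump leqNgt ltn_ord.
  by rewrite mnmwiden_widen mnmE -val_eqE /= gtn_eqF // ?mul0n ?muln0 addn0.
by rewrite mnmwiden_ordmax eqxx ?muln1 ?mul1n add0n.
Qed.

(** The inverse of [muni] is the evaluation at the last variable. *)
Lemma muni_bij (R : comNzRingType) n : bijective (@muni n R).
Proof.
pose g (P : {poly {mpoly R[n]}}) := (map_poly (@mwiden n R) P).['X_ord_max].
have gD P Q : g (P + Q) = g P + g Q by rewrite /g raddfD hornerD.
exists g => [p|P].
  elim/mpolyind: p => [|c m p _ _ IH].
    by rewrite muni0 /g rmorph0 horner0.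
  have gX : g (muni (c *: 'X_[m])) = c *: 'X_[m] := mmultiK_monomial c m.
  by rewrite muniD gD; exact: (congr2 +%R gX IH).
elim/poly_ind: P => [|P c IH]; first by rewrite /g rmorph0 horner0 muni0.
rewrite /g rmorphD rmorphM /= map_polyX map_polyC hornerMXaddC -/(g P).
by rewrite muniD muniM IH muniX muni_mwiden.
Qed.

Lemma factorial_mpoly (K : fieldType) n : factorial_domain {mpoly K[n]}.
Proof.
elim: n => [|n IH]; last first.
  exact: (factorial_iso (phi := @muni n K) (muni_bij K n) (factorial_poly IH)).
move=> u u0; exists u, [::]; split=> //; last by rewrite big_nil mulr1.
have uE : u = (u@_0%MM)%:MP.
  apply/mpolyP => m; rewrite mcoeffC.
  by rewrite (_ : m = 0%MM) ?eqxx ?mulr1 //; apply/mnmP => -[].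
have c0 : u@_0%MM != 0 by apply: contraNneq u0 => c0; rewrite uE c0.
by rewrite uE; apply: (rmorph_unit (@mpolyC 0 K)); rewrite unitfE.
Qed.

(** * The resultant of h and Y - g *)

(** The dimensions are arguments, and not read off the sizes of h and q, so that
    the matrix commutes with every ring morphism. *)
Definition sylvester (A : comNzRingType) s n (h q : {poly A}) : 'M[A]_(s + n) :=
  col_mx (\matrix_(i < s) poly_rV ('X^i * q))
         (\matrix_(i < n) poly_rV ('X^i * h)).

Lemma map_sylvester (A B : comNzRingType) (phi : {rmorphism A -> B}) s n
    (h q : {poly A}) :
  map_mx phi (sylvester s n h q) =
  sylvester s n (map_poly phi h) (map_poly phi q).
Proof.
rewrite map_col_mx; congr col_mx; apply/matrixP => i j;
  by rewrite !mxE !coefXnM; case: ifP => _; rewrite ?rmorph0 // coef_map.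
Qed.

Lemma sum_rVpoly (A : nzRingType) d (v : 'rV[A]_d) :
  rVpoly v = \sum_(i < d) v 0 i *: 'X^i.
Proof.
rewrite /rVpoly poly_def; apply: eq_bigr => i _.
by rewrite insubT //= => lti; congr (v 0 _ *: _); apply/val_inj.
Qed.

(** Divide the rows X^i q by h: in the basis 1, ..., X^(s-1), h, ..., X^(n-1) h
    the Sylvester matrix becomes block triangular with diagonal blocks M and 1,
    while the change of basis is triangular with diagonal entries 1 and h_s. *)
Lemma det_sylvester (A : comNzRingType) s n (h q : {poly A}) (M : 'M[A]_s)
    (Q : 'I_s -> {poly A}) :
  (size h <= s.+1)%N -> (forall i, (size (Q i) <= n)%N) ->
  (forall i : 'I_s, 'X^i * q = rVpoly (row i M) + Q i * h) ->
  \det (sylvester s n h q) = \det M * h`_s ^+ n.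
Proof.
move=> sh sQ qE.
pose N := \matrix_(i < s) (poly_rV (Q i) : 'rV_n).
pose B : 'M[A]_(s + n) :=
  col_mx (\matrix_(i < s) poly_rV 'X^i) (\matrix_(i < n) poly_rV ('X^i * h)).
have -> : sylvester s n h q = block_mx M N 0 1%:M *m B.
  rewrite mul_block_col mul0mx add0r mul1mx; congr col_mx.
  apply/row_matrixP => i; rewrite rowK qE linearD linearD /= !row_mul.
  rewrite !mulmx_sum_row sum_rVpoly !linear_sum /=; congr (_ + _).
    by apply: eq_bigr => k _; rewrite linearZ rowK.
  rewrite -[in LHS](poly_rV_K (sQ i)) sum_rVpoly mulr_suml linear_sum /=.
  by apply: eq_bigr => k _; rewrite -scalerAl linearZ !rowK.
rewrite det_mulmx det_ublock det1 mulr1; congr (_ * _).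
have trB : is_trig_mx B.
  apply/is_trig_mxP => i j; rewrite /B mxE; case: splitP => k ->;
    rewrite !mxE => ltj.
    by rewrite coefXn gtn_eqF.
  rewrite coefXnM; case: ifP => // _; rewrite nth_default // (leq_trans sh) //.
  by rewrite -addn1 leq_subRL ?addn1; [|]; lia.
rewrite det_trig // big_split_ord /= big1 ?mul1r => [|i _]; last first.
  by rewrite col_mxEu !mxE coefXn eqxx.
rewrite -[in RHS](card_ord n) -prodr_const; apply: eq_bigr => i _.
by rewrite col_mxEd !mxE coefXnM /= ltnNge leq_addl /= addnK.
Qed.

(** The matrix of the multiplication by g on F[X]/(h), acting on row vectors. *)
Definition mulmod_mx (F : fieldType) s (h g : {poly F}) : 'M[F]_s :=
  \matrix_(i < s) poly_rV (('X^i * g) %% h).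

Lemma mulmx_mulmod (F : fieldType) s (h g : {poly F}) (v : 'rV_s) :
  v *m mulmod_mx s h g = poly_rV ((rVpoly v * g) %% h).
Proof.
rewrite mulmx_sum_row sum_rVpoly mulr_suml.
rewrite (big_morph _ (modpD h) (mod0p h)) linear_sum.
by apply: eq_bigr => i _; rewrite rowK -scalerAl modpZl linearZ.
Qed.

Lemma mulmx_horner_mulmod (F : fieldType) s (h g p : {poly F}) (v : 'rV_s.+1) :
  size h = s.+2 ->
  v *m horner_mx (mulmod_mx s.+1 h g) p = poly_rV ((rVpoly v * (p \Po g)) %% h).
Proof.
move=> sh.
have small x : (size (x %% h)%R <= s.+1)%N.
  by rewrite -ltnS -sh ltn_modp -size_poly_eq0 sh.
elim/poly_ind: p => [|p c IH].
  by rewrite rmorph0 comp_poly0 mulr0 mod0p mulmx0 linear0.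
rewrite comp_poly_MXaddC rmorphD rmorphM /= horner_mx_X horner_mx_C.
rewrite mulmxDr mulmxA IH mulmx_mulmod poly_rV_K //.
rewrite mul_mx_scalar mulrDr modpD linearD /= mulr_polyC modpZl linearZ /=.
rewrite [rVpoly v %% h]modp_small ?rVpolyK; last first.
  by rewrite sh ltnS; apply: size_poly.
by rewrite mulrA mulrC modp_mul mulrC.
Qed.

Lemma horner_mulmod0 (F : fieldType) s (h g f : {poly F}) :
  size h = s.+2 -> h %| f \Po g -> horner_mx (mulmod_mx s.+1 h g) f = 0.
Proof.
move=> sh hfg; apply/row_matrixP => i; rewrite row0 rowE mulmx_horner_mulmod //.
by rewrite (eqP (dvdp_mull _ hfg)) linear0.
Qed.

(** As in the proof of the Cayley-Hamilton theorem, f(G) = 0 makes the scalar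
    matrix f(Y) a multiple of Y - G; it remains to take determinants. *)
Lemma char_poly_dvd_exp (F : fieldType) s (G : 'M[F]_s.+1) (f : {poly F}) :
  horner_mx G f = 0 -> char_poly G %| f ^+ s.+1.
Proof.
move=> fG; have [phi [phiB phiZ phiC _]] := mx_poly_ring_isom F s.
have /factor_theorem[q qE] : root (map_poly scalar_mx f) G by apply/rootP.
have [psi phiK psiK] := phiB.
have : f%:M = psi q *m char_poly_mx G.
  apply: (can_inj phiK); rewrite phiZ qE rmorphM /= psiK; congr (_ * _).
  by rewrite rmorphB phiC phiZ map_polyX.
move/(congr1 determinant); rewrite det_scalar det_mulmx => ->.
exact: dvdp_mull.
Qed.

(** The minimal polynomial of G divides f, hence is f up to a constant, and it
    divides the characteristic polynomial. *)
Lemma irreducible_size_annihilator (F : fieldType) s (G : 'M[F]_s.+1)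
    (f : {poly F}) :
  irreducible_poly f -> horner_mx G f = 0 -> (size f <= s.+2)%N.
Proof.
move=> irr /mxminpoly_min mf.
have := irr.2 _ _ mf; rewrite size_mxminpoly eqSS -lt0n mxminpoly_nonconstant.
move=> /(_ isT)/eqp_size <-; rewrite -(size_char_poly G).
apply: dvdp_leq (mxminpoly_dvd_char G).
by rewrite -size_poly_eq0 size_char_poly.
Qed.

(** The polynomial S is the resultant of h(X) and Y - g(X) with respect to X. *)
Lemma integral_char_poly (R : idomainType) s n (h g : {poly R}) :
  size h = s.+2 -> (size g <= n.+1)%N -> exists S : {poly R},
  fracp S = tofrac (lead_coef h ^+ n)
            *: char_poly (mulmod_mx s.+1 (fracp h) (fracp g)).
Proof.
move=> sh sg; set G := mulmod_mx _ _ _.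
exists (\det (sylvester s.+1 n h^:P ('X%:P - g^:P))).
have mapP (p : {poly R}) : map_poly (map_poly (@tofrac R)) p^:P = (fracp p)^:P.
  by rewrite -!map_poly_comp; apply: eq_map_poly => x /=; rewrite map_polyC.
rewrite -det_map_mx map_sylvester mapP rmorphB /= map_polyC /= map_polyX mapP.
have small x : (size (x %% fracp h)%R <= s.+1)%N.
  by rewrite -ltnS -sh -size_fracp ltn_modp -size_poly_eq0 size_fracp sh.
rewrite (@det_sylvester _ _ _ _ _ (char_poly_mx G)
  (fun i => - (('X^i * fracp g) %/ fracp h)^:P)).
- rewrite coef_map /= coef_map /= lead_coefE sh -polyC_exp -rmorphXn /=.
  by rewrite mulr_polyC.
- by rewrite size_map_polyC size_fracp sh.
- move=> i; rewrite size_polyN size_map_polyC.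
  rewrite size_divp -?size_poly_eq0 size_fracp sh //=.
  have := size_polyMleq 'X^i (fracp g); rewrite size_polyXn size_fracp.
  move=> szA; rewrite leq_subLR; apply: leq_trans szA _.
  by have := ltn_ord i; move: (size g) sg; lia.
move=> i; have -> : rVpoly (row i (char_poly_mx G)) =
    'X^i * 'X%:P - (('X^i * fracp g) %% fracp h)^:P.
  rewrite /char_poly_mx linearB linearB /= -map_row -map_rVpoly rowK poly_rV_K //.
  by rewrite rowE mul_mx_scalar linearZ /= rVpoly_delta mulr_polyC.
rewrite mulrBr -addrA mulNr -opprD; congr (_ - _).
rewrite -(map_polyXn (@polyC _) i) -!rmorphM -rmorphD /=; congr (_^:P).
by rewrite addrC -divp_eq.
Qed.

(** * Degree functions and Newton polygons *)

(** The opposite of a discrete valuation. The value at 0 is constrained only by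
    the second condition, so estimates carry a separate case for 0. *)
Definition degree_fun (R : idomainType) (D : R -> nat) : Prop :=
  (forall x y, x != 0 -> y != 0 -> D (x * y) = (D x + D y)%N) /\
  (forall x y, (D (x + y)%R <= maxn (D x) (D y))%N).

Section DegreeFun.
Variables (R : idomainType) (D : R -> nat).
Hypothesis DP : degree_fun D.

Lemma degree1 : D 1 = 0%N.
Proof.
by have := DP.1 _ _ (oner_neq0 R) (oner_neq0 R); rewrite mulr1; move: (D 1); lia.
Qed.

Lemma degreeN x : D (- x) = D x.
Proof.
have [->|x0] := eqVneq x 0; first by rewrite oppr0.
have N1 : -1 != 0 :> R by rewrite oppr_eq0 oner_neq0.
have := DP.1 _ _ N1 N1; rewrite mulrNN mulr1 degree1 => D1.
have D1' : D (-1) = 0%N by move: D1; move: (D (-1)); lia.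
by rewrite -mulN1r DP.1 // D1'.
Qed.

Lemma degreeX x k : x != 0 -> D (x ^+ k) = (k * D x)%N.
Proof.
move=> x0; elim: k => [|k IH]; first by rewrite expr0 degree1.
by rewrite exprS DP.1 ?expf_neq0 // IH mulSn.
Qed.

Lemma degree_divides x y : y != 0 -> divides x y -> (D x <= D y)%N.
Proof.
move=> y0 [c yE]; move: y0; rewrite yE mulf_eq0 negb_or => /andP[c0 x0].
by rewrite DP.1 // leq_addl.
Qed.

Lemma degree_dominant x y : x != 0 -> y = 0 \/ (D y < D x)%N ->
  x + y != 0 /\ D (x + y) = D x.
Proof.
move=> x0 [->|ltyx]; first by rewrite addr0.
split.
  apply: contraTneq ltyx => /eqP; rewrite addr_eq0 => /eqP->.
  by rewrite degreeN ltnn.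
apply/eqP; rewrite eqn_leq; apply/andP; split.
  by apply: leq_trans (DP.2 x y) _; rewrite geq_max leqnn ltnW.
have := DP.2 (x + y) (- y); rewrite addrK degreeN leq_max => /orP[//|].
by rewrite leqNgt ltyx.
Qed.

Lemma degree_sum (I : Type) (r : seq I) (P : pred I) (F : I -> R) (B : nat) :
  (forall i, P i -> F i = 0 \/ (D (F i) < B)%N) ->
  \sum_(i <- r | P i) F i = 0 \/ (D (\sum_(i <- r | P i) F i) < B)%N.
Proof.
move=> FB; apply: (big_ind (fun x => x = 0 \/ (D x < B)%N)) => //; first by left.
move=> x y [->|ltx]; first by rewrite add0r.
case=> [->|lty]; first by rewrite addr0; right.
by right; apply: leq_ltn_trans (DP.2 x y) _; rewrite gtn_max ltx.
Qed.

Variables (m e : nat).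
Hypothesis m_gt0 : (0 < m)%N.

(** Up to scaling and a constant, the height of the point (i, D p_i) above the
    line of slope e / m through the origin: the largest weight is the logarithm
    of a Gauss norm on R[Y], in which Y has degree - e / m. *)
Definition weight (p : {poly R}) i := (m * D p`_i + e * ((size p).-1 - i))%N.

(** The leading term realizes the Gauss norm: every edge of the Newton polygon
    has slope at least e/m, or equivalently all roots of p have degree at most
    - e / m. *)
Definition top_heavy (p : {poly R}) :=
  forall i, p`_i != 0 -> (weight p i <= m * D (lead_coef p))%N.

Lemma weight_lead p : weight p (size p).-1 = (m * D (lead_coef p))%N.
Proof. by rewrite /weight subnn muln0 addn0. Qed.

Lemma coef_neq0_size (p : {poly R}) i : p`_i != 0 -> (i < size p)%N.
Proof. by apply: contraNT; rewrite -leqNgt => /leq_sizeP->. Qed.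

Lemma lex_leq N a b i k : (i < N)%N -> (k < N)%N ->
  (a * N + k <= b * N + i)%N -> (a <= b)%N /\ ((i < k)%N -> (a < b)%N).
Proof.
move=> ltiN ltkN leab; have leb : (a <= b)%N.
  rewrite leqNgt; apply/negP => ltba.
  by have := leq_mul ltba (leqnn N); rewrite mulSn; lia.
by split=> // ltik; rewrite ltn_neqAle leb andbT; apply/eqP => ab; subst; lia.
Qed.

(** A vertex of the Newton polygon: the last index at which the weight is
    maximal. *)
Lemma exists_vertex (p : {poly R}) : p != 0 -> exists2 i, p`_i != 0 &
  forall k, p`_k != 0 ->
    (weight p k <= weight p i)%N /\ ((i < k)%N -> (weight p k < weight p i)%N).
Proof.
move=> p0; have ltd : ((size p).-1 < size p)%N by rewrite prednK // size_poly_gt0.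
pose key (i : 'I_(size p)) := (weight p i * size p + i)%N.
have lc0 : p`_(Ordinal ltd) != 0 by rewrite -lead_coefE lead_coef_eq0.
case: (@arg_maxnP _ (Ordinal ltd) (fun i : 'I_(size p) => p`_i != 0) key lc0).
move=> i pi0 maxi; exists (i : nat) => // k pk0.
have ltk := coef_neq0_size pk0; have lti := ltn_ord i.
exact: lex_leq lti ltk (maxi (Ordinal ltk) pk0).
Qed.

(** Multiplicativity of the Gauss norm: at the sum of two last vertices a single
    product of coefficients dominates, since any other index lies beyond one of
    the two vertices. *)
Lemma coef_vertexM (p q : {poly R}) i k : p`_i != 0 -> q`_k != 0 ->
  (forall l, p`_l != 0 ->
    (weight p l <= weight p i)%N /\ ((i < l)%N -> (weight p l < weight p i)%N)) ->
  (forall l, q`_l != 0 ->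
    (weight q l <= weight q k)%N /\ ((k < l)%N -> (weight q l < weight q k)%N)) ->
  (p * q)`_(i + k) != 0 /\ D (p * q)`_(i + k) = (D p`_i + D q`_k)%N.
Proof.
move=> pi0 qk0 maxp maxq; have lti : (i < (i + k).+1)%N by rewrite ltnS leq_addr.
rewrite coefM (bigD1 (Ordinal lti)) //= addKn -DP.1 //.
apply: degree_dominant; first by rewrite mulf_neq0.
apply: degree_sum => l; rewrite -val_eqE /= => neli.
have [->|pl0] := eqVneq p`_l 0; first by left; rewrite mul0r.
have [->|ql0] := eqVneq q`_(i + k - l) 0; first by left; rewrite mulr0.
right; rewrite !DP.1 //.
have [lep ltp] := maxp _ pl0; have [leq ltq] := maxq _ ql0.
have sl := coef_neq0_size pl0; have sl' := coef_neq0_size ql0.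
have si := coef_neq0_size pi0; have sk := coef_neq0_size qk0.
have ltl := ltn_ord l.
have eqe : (e * ((size p).-1 - l) + e * ((size q).-1 - (i + k - l)) =
            e * ((size p).-1 - i) + e * ((size q).-1 - k))%N.
  by rewrite -!mulnDr; congr (_ * _)%N; lia.
rewrite -(ltn_pmul2l m_gt0) !mulnDr.
rewrite -(ltn_add2r (e * ((size p).-1 - i) + e * ((size q).-1 - k))) -{1}eqe.
rewrite addnACA [X in (_ < X)%N]addnACA.
move: neli; rewrite neq_ltn => /orP[ltli|ltil].
  have /ltq ltw : (k < i + k - l)%N by lia.
  by rewrite -addnS leq_add.
by rewrite -addSn leq_add ?ltp.
Qed.

(** The largest weights of p and q add up to that of p * q, which the leading
    terms realize; so they realize it in each factor. *)
Lemma top_heavy_factor (p q : {poly R}) :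
  p != 0 -> q != 0 -> top_heavy (p * q) -> top_heavy p.
Proof.
move=> p0 q0 top; have [i pi0 maxp] := exists_vertex p0.
have [k qk0 maxq] := exists_vertex q0.
have [c0 cE] := coef_vertexM pi0 qk0 maxp maxq.
move: (top _ c0); rewrite /weight cE lead_coefM DP.1 ?lead_coef_eq0 // size_mul //.
have lp0 : p`_(size p).-1 != 0 by rewrite -lead_coefE lead_coef_eq0.
have lq0 : q`_(size q).-1 != 0 by rewrite -lead_coefE lead_coef_eq0.
have [lep _] := maxp _ lp0; have [leq _] := maxq _ lq0.
rewrite !weight_lead in lep leq.
have si := coef_neq0_size pi0; have sk := coef_neq0_size qk0.
have -> : ((size p + size q).-1.-1 - (i + k) =
  ((size p).-1 - i) + ((size q).-1 - k))%N by lia.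
rewrite !mulnDr => le_sum l /maxp[lel _]; apply: leq_trans lel _.
by move: lep leq le_sum; rewrite /weight; lia.
Qed.

Lemma top_heavyM (p q : {poly R}) :
  top_heavy p -> top_heavy q -> top_heavy (p * q).
Proof.
have [->|p0] := eqVneq p 0; first by rewrite mul0r.
have [->|q0] := eqVneq q 0; first by rewrite mulr0.
move=> topp topq l; set B := (m * D (lead_coef (p * q)))%N => pql0.
have sl := coef_neq0_size pql0; rewrite size_mul // in sl.
rewrite leqNgt; apply/negP => ltB; move/eqP: pql0; apply.
have [//|] : (p * q)`_l = 0 \/ (D (p * q)`_l < D (p * q)`_l)%N;
  last by rewrite ltnn.
rewrite {1 2}coefM; apply: degree_sum => i _.
have [->|pi0] := eqVneq p`_i 0; first by left; rewrite mul0r.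
have [->|qi0] := eqVneq q`_(l - i) 0; first by left; rewrite mulr0.
right; rewrite DP.1 //; have lep := topp _ pi0; have leq := topq _ qi0.
have si := coef_neq0_size pi0; have sk := coef_neq0_size qi0.
move: ltB; rewrite /B /weight lead_coefM DP.1 ?lead_coef_eq0 // size_mul //.
have lti := ltn_ord i.
have -> : ((size p + size q).-1.-1 - l =
  ((size p).-1 - i) + ((size q).-1 - (l - i)))%N by lia.
rewrite !mulnDr => ltB; rewrite -(ltn_pmul2l m_gt0) mulnDr.
rewrite -(ltn_add2r (e * ((size p).-1 - i) + e * ((size q).-1 - (l - i)))).
rewrite addnACA.
exact: leq_ltn_trans (leq_add lep leq) ltB.
Qed.

Lemma top_heavyC c : top_heavy c%:P.
Proof.
move=> i; rewrite /weight coefC lead_coefC size_polyC.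
by case: i => [|i]; rewrite ?eqxx // subn0; case: eqP => // _; rewrite muln0 addn0.
Qed.

Lemma top_heavyX p k : top_heavy p -> top_heavy (p ^+ k).
Proof.
move=> top; elim: k => [|k IH]; first by rewrite expr0; apply: top_heavyC.
by rewrite exprS; apply: top_heavyM.
Qed.

(** S is the resultant of h(X) and Y - g(X); it is top heavy because it divides a
    constant times a power of f. Its leading coefficient is t^n for t the
    leading coefficient of h. Its constant coefficient is, up to sign, the
    resultant of h and g; it is a nonzero element of R, hence of nonnegative
    degree, and its weight is at least e times the degree of h. *)
Lemma factor_lead_degree (f g h : {poly R}) n s :
  f`_0 != 0 -> top_heavy f -> (size g <= n.+1)%N -> size h = s.+2 ->
  fracp h %| fracp (f \Po g) -> (e * s.+1 <= m * n * D (lead_coef h))%N.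
Proof.
move=> f0 topf sg sh hfg.
have h0 : h != 0 by rewrite -size_poly_eq0 sh.
have t0 : lead_coef h != 0 by rewrite lead_coef_eq0.
have tn0 : lead_coef h ^+ n != 0 by rewrite expf_neq0.
have [S SE] := integral_char_poly sh sg.
move: SE; set G := mulmod_mx _ _ _ => SE.
have fG : horner_mx G (fracp f) = 0.
  by apply: horner_mulmod0; rewrite ?size_fracp // -map_comp_poly.
have /dvdpP[M ME] := char_poly_dvd_exp fG.
have [a a0 [M' M'E]] := clear_denominators M.
have SM : M' * S = (a * lead_coef h ^+ n)%:P * f ^+ s.+1.
  apply: fracp_inj; rewrite mul_polyC map_polyZ (rmorphXn (map_poly _)) ME.
  by rewrite rmorphM /= SE M'E -scalerAl -scalerAr scalerA tofracM.
have sS : size S = s.+2.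
  by rewrite -size_fracp SE size_scale ?tofrac_eq0 // size_char_poly.
have lS : lead_coef S = lead_coef h ^+ n.
  apply: tofrac_inj; rewrite lead_coefE -coef_map SE coefZ.
  have := monicP (char_poly_monic G); rewrite lead_coefE size_char_poly sS => ->.
  by rewrite mulr1.
have S0 : S`_0 != 0.
  have : (M' * S)`_0 != 0.
    rewrite SM coefCM mulf_neq0 ?mulf_neq0 // -horner_coef0 horner_exp.
    by rewrite expf_neq0 // horner_coef0.
  by apply: contraNneq => S0; rewrite coefM big_ord1 S0 mulr0.
have topS : top_heavy S.
  apply: (@top_heavy_factor _ M').
  - by rewrite -size_poly_eq0 sS.
  - apply: contraNneq S0 => M0; move: SM; rewrite M0 mul0r => /esym/eqP.
    rewrite mulf_eq0 polyC_eq0 mulf_eq0 (negPf a0) (negPf tn0) /= expf_eq0 /=.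
    by move/eqP => fE; move: f0; rewrite fE coef0 eqxx.
  by rewrite mulrC SM; apply: top_heavyM; [apply: top_heavyC | apply: top_heavyX].
have := topS _ S0; rewrite /weight lS degreeX // sS subn0 /= mulnA.
exact: leq_trans (leq_addl _ _).
Qed.

End DegreeFun.

(** * The degree in one variable *)

(** The substitution of X_j * T for X_j: it turns the degree in X_j into the
    degree in the new variable T, which is multiplicative. *)
Definition scale_var (R : comNzRingType) n (j : 'I_n) (u : {mpoly R[n]}) :
    {poly {mpoly R[n]}} :=
  mmap (@polyC _ \o @mpolyC n R) (fun i => ('X_i)%:P * 'X^(i == j)) u.

Lemma scale_varM (R : comNzRingType) n (j : 'I_n) (u v : {mpoly R[n]}) :
  scale_var j (u * v) = scale_var j u * scale_var j v.
Proof.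
exact: (mmap_is_multiplicative _ (@polyC {mpoly R[n]} \o @mpolyC n R)).1.
Qed.

Lemma scale_varD (R : comNzRingType) n (j : 'I_n) (u v : {mpoly R[n]}) :
  scale_var j (u + v) = scale_var j u + scale_var j v.
Proof. exact: mmapD. Qed.

Lemma mcoeff_scale_var (R : comNzRingType) n (j : 'I_n) (u : {mpoly R[n]}) k mon :
  ((scale_var j u)`_k)@_mon = if k == mon j then u@_mon else 0.
Proof.
have monE (mn : 'X_{1..n}) :
    mmap1 (fun i => ('X_i)%:P * 'X^(i == j)) mn
    = ('X_[mn])%:P * 'X^(mn j) :> {poly {mpoly R[n]}}.
  rewrite /mmap1 (eq_bigr (fun i => ('X_i ^+ mn i)%:P * 'X^((i == j) * mn i))).
    rewrite big_split /= -rmorph_prod /= -mpolyXE_id prodrXr (bigD1 j) //=.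
    by rewrite eqxx mul1n big1 ?addn0 // => i /negPf->.
  by move=> i _; rewrite exprMn -exprM polyC_exp.
rewrite /scale_var /mmap coef_sum raddf_sum /=.
under eq_bigr => mn _ do
  rewrite monE mulrA -polyCM coefCM coefXn mul_mpolyC -scalerAl mcoeffZ.
have [monu|monu] := boolP (mon \in msupp u).
  rewrite (bigD1_seq mon) //= ?msupp_uniq // big1 ?addr0 => [|mn ne].
    case: eqP => _; rewrite ?mulr1 ?mulr0 ?mcoeff0 ?mulr0 //.
    by rewrite mcoeffX eqxx mulr1.
  case: eqP => _; rewrite ?mulr1 ?mulr0 ?mcoeff0 ?mulr0 //.
  by rewrite mcoeffX (negPf ne) mulr0.
rewrite (memN_msupp_eq0 monu) if_same big1_seq // => mn /= mnu.
have ne : mn != mon by apply: contraNneq monu => <-.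
case: eqP => _; rewrite ?mulr1 ?mulr0 ?mcoeff0 ?mulr0 //.
by rewrite mcoeffX (negPf ne) mulr0.
Qed.

Lemma mpoly_neq0_coef (R : nzRingType) n (u : {mpoly R[n]}) :
  u != 0 -> exists mon, u@_mon != 0.
Proof.
rewrite -msupp_eq0; case E: (msupp u) => [|mon s] // _; exists mon.
by rewrite -mcoeff_msupp E inE eqxx.
Qed.

Lemma pred_sizeM (R : idomainType) (p q : {poly R}) : p != 0 -> q != 0 ->
  (size (p * q)).-1 = ((size p).-1 + (size q).-1)%N.
Proof.
move=> p0 q0; rewrite size_mul //; move: p0 q0; rewrite -!size_poly_gt0.
by case: (size p) (size q) => [|a] [|b]; rewrite // addnS.
Qed.

Lemma degX_degree_fun (K : fieldType) n (j : 'I_n) : degree_fun (@degX K n j).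
Proof.
have pred_max a b c : (c <= maxn a b)%N -> (c.-1 <= maxn a.-1 b.-1)%N by lia.
have degXE (u : {mpoly K[n]}) : degX j u = (size (scale_var j u)).-1.
  have [->|u0] := eqVneq u 0.
    by rewrite /degX msupp0 big_nil /scale_var raddf0 size_poly0.
  have coef_supp mon : mon \in msupp u -> (scale_var j u)`_(mon j) != 0.
    rewrite mcoeff_msupp; apply: contraNneq => /(congr1 (mcoeff mon)).
    by rewrite mcoeff_scale_var eqxx mcoeff0 => ->.
  apply/eqP; rewrite eqn_leq; apply/andP; split.
    apply/bigmax_leqP_seq => mon /coef_supp/coef_neq0_size.
    by case: (size _).
  have : scale_var j u != 0.
    have [mon monu] := mpoly_neq0_coef u0; rewrite -mcoeff_msupp in monu.
    by apply: contraNneq (coef_supp _ monu) => ->; rewrite coef0.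
  rewrite -lead_coef_eq0 lead_coefE; move: (_.-1) => k /mpoly_neq0_coef[mon].
  rewrite mcoeff_scale_var.
  have [-> umon|_] := eqVneq k (mon j); last by rewrite eqxx.
  by apply: leq_bigmax_seq; rewrite ?mcoeff_msupp.
have scale_var_neq0 (x : {mpoly K[n]}) : x != 0 -> scale_var j x != 0.
  apply: contraNneq => mx; apply/eqP/mpolyP => mon.
  by have := mcoeff_scale_var j x (mon j) mon; rewrite mx coef0 eqxx !mcoeff0 => <-.
split=> [x y x0 y0|x y]; rewrite !degXE.
  rewrite scale_varM.
  exact: (pred_sizeM (scale_var_neq0 x x0) (scale_var_neq0 y y0)).
rewrite scale_varD; exact: pred_max (size_polyD _ _).
Qed.

(** Modulo h, the polynomial g is a root of f. *)
Lemma irreducible_size_leq_factor (R : idomainType) (f g h : {poly R}) s :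
  size h = s.+2 -> irreducible_poly (fracp f) -> fracp h %| fracp (f \Po g) ->
  (size f <= s.+2)%N.
Proof.
move=> sh irrf hfg; rewrite -size_fracp.
pose G := mulmod_mx s.+1 (fracp h) (fracp g).
apply: (irreducible_size_annihilator (G := G)) => //.
by apply: horner_mulmod0; rewrite ?size_fracp // -map_comp_poly.
Qed.

Lemma nb_factors_primes (R : idomainType) (u : R) k :
  factorial_domain R -> nb_factors u k -> exists c (s : seq R),
    [/\ c \is a GRing.unit, u = c * \prod_(q <- s) q,
        forall q, q \in s -> prime_elt q & size s = k].
Proof.
move=> facR [c [s [cU uE sP sk]]]; exists c, s; split=> // q /sP.
exact: irreducible_prime.
Qed.

(** The primes of e1 * e2 ^+ m are fewer than the irreducible factors of U, so
    some factor has a leading coefficient that takes none of them. *)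
Lemma exists_light_factor (K : fieldType) N (U : {poly {mpoly K[N]}})
    (d1 e1 d2 e2 : {mpoly K[N]}) m :
  U != 0 -> lead_coef U = d1 * e1 * (d2 * e2) ^+ m ->
  (Omega e1 + m * Omega e2 < Omega (fracp U))%N ->
  exists h : {poly {mpoly K[N]}}, [/\ irreducible_poly (fracp h),
    fracp h %| fracp U
    & exists2 c : {mpoly K[N]}, c \is a GRing.unit
      & divides (lead_coef h) (c * (d1 * d2 ^+ m))].
Proof.
move=> U0 lU ltO; have facR := @factorial_mpoly K N.
have := U0; rewrite -lead_coef_eq0 lU !mulf_eq0 !negb_or.
case/andP=> /andP[d10 e10] de2.
have [c1 [s1 [c1U e1E s1P s1k]]] := nb_factors_primes facR (OmegaP_mpoly e10).
have [c2 [s2 [c2U e2E s2P s2k]]] : exists c2 (s2 : seq {mpoly K[N]}),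
    [/\ c2 \is a GRing.unit, e2 ^+ m = c2 * \prod_(q <- s2) q,
        forall q, q \in s2 -> prime_elt q & size s2 = (m * Omega e2)%N].
  case: (m) de2 => [|m'] de2; first by exists 1, [::]; rewrite big_nil mulr1 unitr1.
  move: de2; rewrite expf_eq0 /= mulf_eq0 negb_or => /andP[_ e20].
  have [c [s [cU eE sP sk]]] := nb_factors_primes facR (OmegaP_mpoly e20).
  exists (c ^+ m'.+1), (flatten (nseq m'.+1 s)); split; first exact: unitrX.
  - rewrite {1}eE exprMn big_flatten big_nseq; congr (_ * _).
    by rewrite -Monoid.iteropE.
  - by move=> q /flattenP[t]; rewrite mem_nseq => /andP[_ /eqP->]; apply: sP.
  by rewrite size_flatten /shape map_nseq sumn_nseq sk mulnC.
have [|c [s [cU UE sP sk]]] := @OmegaP_poly _ (fracp U).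
  by rewrite fracp_eq0.
have [||u [t [tk UE' tP]]] := @gauss_irreducible_factors _ U s facR.
- rewrite UE; move: cU; rewrite poly_unitE => /andP[/size_poly1P[a a0 ->] _].
  by rewrite mul_polyC eqp_scale.
- by move=> q /sP/irreducible_elt_poly.
have [|||x] := @pigeonhole_primes _ (c1 * c2 * (d1 * d2 ^+ m)) u (s1 ++ s2)
  (map (@lead_coef _) t).
- by move=> p; rewrite mem_cat => /orP[/s1P|/s2P].
- rewrite big_map -lead_coef_prod -(lead_coefC u) -lead_coefM -UE' lU exprMn e2E.
  rewrite [in RHS]e1E big_cat /=.
  move: (\prod_(_ <- s1) _) (\prod_(_ <- s2) _) => A B.
  ring.
- by rewrite size_cat size_map s1k s2k tk sk.
case/mapP => h ht -> hD; exists h; split; first exact: tP.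
  by rewrite UE' (perm_big _ (perm_to_rem ht)) big_cons mulrCA rmorphM dvdp_mulr.
by exists (c1 * c2) => //; rewrite unitrM c1U.
Qed.

Lemma degree_unit (R : idomainType) (D : R -> nat) (c : R) :
  degree_fun D -> c \is a GRing.unit -> D c = 0%N.
Proof.
move=> DP cU; have cV0 : c^-1 != 0.
  by rewrite invr_eq0; apply: contraTneq cU => ->; rewrite unitr0.
have c0 : c != 0 by rewrite -invr_eq0.
have := DP.1 _ _ c0 cV0; rewrite divrr // (degree1 DP).
by move: (D c) (D c^-1); lia.
Qed.

Lemma degX_le_Hcoef (K : fieldType) N (j : 'I_N) (f : {poly {mpoly K[N]}}) i :
  (i < (size f).-1)%N -> f`_i != 0 -> (degX j f`_i <= Hcoef j f)%N.
Proof.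
move=> lti fi0; pose P (k : 'I_(size f).-1) := f`_k != 0.
exact: (@leq_bigmax_cond _ P (fun k => degX j f`_k) (Ordinal lti)).
Qed.

(** For i < m, with e the difference of the two degrees compared:
    m D a_i + e (m - i) <= m H_j(f) + e m = m D a_m. *)
Lemma Hcoef_top_heavy (K : fieldType) N (j : 'I_N) (f : {poly {mpoly K[N]}}) :
  (Hcoef j f <= degX j (lead_coef f))%N ->
  top_heavy (@degX K N j) (size f).-1 (degX j (lead_coef f) - Hcoef j f) f.
Proof.
move=> leH i fi0; have := coef_neq0_size fi0; rewrite /weight.
have [-> _|ni] := eqVneq i (size f).-1.
  by rewrite subnn muln0 addn0 -lead_coefE.
move=> lti; have lti' : (i < (size f).-1)%N.
  by move: ni lti; case: (size f) => // d; rewrite ltnS leq_eqVlt => /negPf->.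
have leD := degX_le_Hcoef j lti' fi0.
set e := (_ - _)%N; set d := (size f).-1.
apply: leq_trans (_ : d * Hcoef j f + e * d <= _)%N.
  by rewrite leq_add ?leq_mul2l ?leD ?leq_subr ?orbT.
by rewrite [X in (_ + X)%N]mulnC -mulnDr subnKC.
Qed.

Theorem corollary5 (K : fieldType) (r m n : nat)
    (a b : nat -> {mpoly K[r.-1]}) (d1 e1 d2 e2 : {mpoly K[r.-1]})
    (j : 'I_(r.-1)) (f g : {poly {mpoly K[r.-1]}})
    (hr : (2 <= r)%N) (hm : (1 <= m)%N) (hn : (1 <= n)%N)
    (hf : f = \sum_(i < m.+1) a i *: 'X^i)
    (hg : g = \sum_(i < n.+1) b i *: 'X^i)
    (h0 : a 0%N * a m * b n != 0)
    (hd1 : a m = d1 * e1) (hd2 : b n = d2 * e2) :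
  ((m * n * degX j d1 + m ^ 2 * n * degX j d2 + Hcoef j f < degX j (a m))%N ->
     (Omega (map_poly (@tofrac {mpoly K[r.-1]}) (f \Po g))
        <= Omega e1 + m * Omega e2)%N)
  /\
  (irreducible_poly (map_poly (@tofrac {mpoly K[r.-1]}) f) ->
   (n * degX j d1 + m * n * degX j d2 + Hcoef j f < degX j (a m))%N ->
     (Omega (map_poly (@tofrac {mpoly K[r.-1]}) (f \Po g))
        <= Omega e1 + m * Omega e2)%N).
Proof.
have DP := degX_degree_fun K j.
move: h0; rewrite !mulf_eq0 !negb_or => /andP[/andP[a0 am] bn].
have sf : size f = m.+1 by rewrite hf -poly_def size_poly_eq.
have sg : size g = n.+1 by rewrite hg -poly_def size_poly_eq.
have lf : lead_coef f = a m by rewrite lead_coefE sf hf -poly_def coef_poly ltnSn.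
have lg : lead_coef g = b n by rewrite lead_coefE sg hg -poly_def coef_poly ltnSn.
have f0 : f`_0 != 0 by rewrite hf -poly_def coef_poly.
have lU : lead_coef (f \Po g) = d1 * e1 * (d2 * e2) ^+ m.
  by rewrite lead_coef_comp ?sg // lf lg sf hd1 hd2.
have U0 : f \Po g != 0.
  by rewrite -lead_coef_eq0 lU -hd1 -hd2 mulf_neq0 ?expf_neq0.
have d10 : d1 != 0 by apply: contraNneq am => d0; rewrite hd1 d0 mul0r.
have d20 : d2 != 0 by apply: contraNneq bn => d0; rewrite hd2 d0 mul0r.
(* The degree s.+1 of the light factor is at least 1 in general and at least m
   when f is irreducible: this is the only difference between the two parts. *)
have main : (Hcoef j f < degX j (a m))%N ->
    (Omega e1 + m * Omega e2 < Omega (fracp (f \Po g)))%N ->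
  exists s, [/\ irreducible_poly (fracp f) -> (m <= s.+1)%N
    & ((degX j (a m) - Hcoef j f) * s.+1
       <= m * n * (degX j d1 + m * degX j d2))%N].
  move=> ltH ltO; have [h [hirr hU [c cU hD]]] := exists_light_factor U0 lU ltO.
  have := hirr.1; rewrite size_fracp.
  case sh : (size h) => [|[|s]] // _; exists s; split.
    move=> firr; rewrite -ltnS -sf.
    exact: irreducible_size_leq_factor sh firr hU.
  have topf := @Hcoef_top_heavy _ _ j f; rewrite lf sf /= in topf.
  have sgn : (size g <= n.+1)%N by rewrite sg.
  apply: leq_trans (factor_lead_degree DP hm f0 (topf (ltnW ltH)) sgn sh hU) _.
  rewrite leq_mul2l; apply/orP; right.
  have c0 : c != 0 by apply: contraTneq cU => ->; rewrite unitr0.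
  apply: leq_trans (degree_divides DP _ hD) _.
    by rewrite !mulf_neq0 ?expf_neq0.
  by rewrite !DP.1 ?mulf_neq0 ?expf_neq0 // (degree_unit DP cU) (degreeX DP).
split=> [|firr] lt; rewrite leqNgt; apply/negP => ltO.
  have [|s [_]] := main _ ltO.
    by apply: leq_ltn_trans lt; rewrite leq_addl.
  apply/negP; rewrite -ltnNge; apply: leq_trans (leq_pmulr _ (ltn0Sn s)).
  rewrite ltn_subRL addnC; apply: leq_ltn_trans lt.
  by rewrite leq_add2r; apply/eq_leq; ring.
have [|s [/(_ firr) lems]] := main _ ltO.
  by apply: leq_ltn_trans lt; rewrite leq_addl.
apply/negP; rewrite -ltnNge.
apply: leq_trans (_ : (degX j (a m) - Hcoef j f) * m <= _)%N; last first.
  by rewrite leq_mul2l lems orbT.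
rewrite -mulnA mulnC ltn_pmul2r // ltn_subRL addnC; apply: leq_ltn_trans lt.
by rewrite leq_add2r; apply/eq_leq; ring.
Qed.
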